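(* Let $A,B,B_0>0$ and $\alpha>\beta>1$. For each $N\ge2$ let $P^{(N)}=(p^{(N)}_0,\dots,p^{(N)}_{N-1})$, with $p_0^{(N)}<\dots<p_{N-1}^{(N)}$, be a minimizer of $P\mapsto U(\mathfrak{S}_P)$ over all $P\in\mathbb{R}^N$ with strictly increasing coordinates, and let $x^{(N)}_k=(p_k^{(N)},0,0)$ be the positions of the particles of the spear $\mathfrak{S}_{P^{(N)}}$. Then there exist indices $k_N\in\{0,\dots,N-2\}$, $N\ge 2$, such that the distance $|x^{(N)}_{k_N+1}-x^{(N)}_{k_N}|$ does not converge to $\bar h$ as $N\to+\infty$, where $$\bar h=\left(\frac{\alpha A\,\zeta(\alpha)}{\beta B\,\zeta(\beta)}\right)^{\frac{1}{\alpha-\beta}} .$$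
   Context: A configuration of $N$ magnetic particles is $(X,M)=((x_0,m_0),\dots,(x_{N-1},m_{N-1}))\in(\mathbb{R}^3\times\mathbb{S}^2)^N$ with pairwise distinct positions. Put $r_{k\ell}=x_k-x_\ell$. The energy is $$U(X,M)=\sum_{k}\sum_{\ell<k}\left(B_0\frac{m_k\cdot m_\ell}{|r_{k\ell}|^{\beta}}-(B+B_0)\frac{(m_k\cdot r_{k\ell})(m_\ell\cdot r_{k\ell})}{|r_{k\ell}|^{\beta+2}}+\frac{A}{|r_{k\ell}|^{\alpha}}\right).$$ For $P=(p_0,\dots,p_{N-1})$ with $p_0<\dots<p_{N-1}$, the spear $\mathfrak{S}_P$ is the configuration $x_k=(p_k,0,0)$, $m_k=(1,0,0)$, $0\le k\le N-1$. Such minimizers exist for every $N\ge 2$. $\zeta(s)=\sum_{n\ge1}n^{-s}$. *)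

(* Defs.v *)
From HB Require Import structures.
From mathcomp Require Import all_boot all_order all_algebra.
From mathcomp Require Import all_classical all_reals all_analysis.
Set Implicit Arguments.
Unset Strict Implicit.
Unset Printing Implicit Defensive.
Import Order.TTheory GRing.Theory Num.Theory.
Import numFieldNormedType.Exports.
Local Open Scope classical_set_scope.
Local Open Scope ring_scope.

Definition dotv (R : realType) (n : nat) (u v : 'rV[R]_n) : R :=
  \sum_(i < n) u 0 i * v 0 i.

(* The library norm `|u| on row vectors is the sup norm, not the Euclidean
   one, hence this definition. *)
Definition enorm (R : realType) (n : nat) (u : 'rV[R]_n) : R :=
  Num.sqrt (dotv u u).

Definition vec3 (R : realType) (a b c : R) : 'rV[R]_3 :=
  \row_(i < 3) [:: a; b; c]`_i.

Definition configuration (R : realType) (N : nat) (X M : 'I_N -> 'rV[R]_3) :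
    Prop :=
  injective X /\ forall k, enorm (M k) = 1.

(* Physical energy when [configuration X M] holds; otherwise possibly a junk
   value, since 0^-1 = 0. *)
Definition energy (R : realType) (A B B0 alpha beta : R) (N : nat)
    (X M : 'I_N -> 'rV[R]_3) : R :=
  \sum_(k < N) \sum_(l < N | (l < k)%N)
    let r := X k - X l in
    (B0 * (dotv (M k) (M l) / enorm r `^ beta)
     - (B + B0) * (dotv (M k) r * dotv (M l) r / enorm r `^ (beta + 2))
     + A / enorm r `^ alpha).

Definition increasing (R : realType) (N : nat) (P : 'rV[R]_N) : Prop :=
  forall k l : 'I_N, (k < l)%N -> P 0 k < P 0 l.

Definition spear_pos (R : realType) (N : nat) (P : 'rV[R]_N) (k : 'I_N) :
    'rV[R]_3 :=
  vec3 (P 0 k) 0 0.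

Definition spear_mom (R : realType) (N : nat) (k : 'I_N) : 'rV[R]_3 :=
  vec3 1 0 0.

Definition spear_energy (R : realType) (A B B0 alpha beta : R) (N : nat)
    (P : 'rV[R]_N) : R :=
  energy A B B0 alpha beta (spear_pos P) (@spear_mom R N).

Definition spear_minimizer (R : realType) (A B B0 alpha beta : R) (N : nat)
    (P : 'rV[R]_N) : Prop :=
  increasing P /\
  forall Q : 'rV[R]_N, increasing Q ->
    spear_energy A B B0 alpha beta P <= spear_energy A B B0 alpha beta Q.

(* Only meaningful for 1 < s, where the series converges. *)
Definition zeta (R : realType) (s : R) : R :=
  limn (series (fun n : nat => n.+1%:R `^ (- s))).

Definition hbar (R : realType) (A B alpha beta : R) : R :=
  (alpha * A * zeta alpha / (beta * B * zeta beta)) `^ (alpha - beta)^-1.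

Lemma spear_configuration (R : realType) (N : nat) (P : 'rV[R]_N) :
  increasing P -> configuration (spear_pos P) (@spear_mom R N).
Proof.
move=> incP; split=> [k l eqX|k]; last first.
  rewrite /enorm /dotv (eq_bigr (fun i : 'I_3 => (i == ord0)%:R)) => [|i _].
    by rewrite (bigD1 ord0) //= big1 ?addr0 ?sqrtr1 // => i /negPf->.
  by rewrite mxE; case: i => [[|[|[|//]]] /= _]; rewrite ?mulr1 ?mulr0.
have {eqX} eqP : P 0 k = P 0 l.
  by have /rowP/(_ ord0) := eqX; rewrite [LHS]mxE [RHS]mxE.
by case: (ltngtP k l) => [/incP|/incP|/val_inj //]; rewrite eqP ltxx.
Qed.

(* Main.v *)
Require Import Defs.
From HB Require Import structures.
From mathcomp Require Import all_boot all_order all_algebra.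
From mathcomp Require Import all_classical all_reals all_analysis.
From mathcomp Require Import ring lra.
Import Order.TTheory GRing.Theory Num.Theory.
Import numFieldNormedType.Exports.
Local Open Scope classical_set_scope.
Local Open Scope ring_scope.

(* If every choice of gaps converged to [h = hbar], the gaps would converge to
   [h] uniformly in the index. Energy does not decrease when the end particle
   is moved outwards, and in the limit this stationarity condition reads
     alpha A zeta(alpha + 1) <= beta B zeta(beta + 1) h^(alpha - beta),
   that is, by the value of [h],
     zeta(alpha + 1) zeta(beta) <= zeta(alpha) zeta(beta + 1).
   A Chebyshev-type rearrangement of the double series gives the opposite strict
   inequality: the equilibrium spacing at an end of a half-infinite chain is not
   the one of the bulk. *)

(** * Convexity of negative powers *)

Lemma powRNB1 {R : realType} (s x : R) : 0 < x ->
  x `^ (- s - 1) = x `^ (- s) / x.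
Proof.
by move=> x0; rewrite powRD ?powR_inv1 ?(ltW x0) // (gt_eqF x0) implybT.
Qed.

(** Convexity: the graph of [x]^ (- s)[lies above its tangent at]y[. Scaling by]y[leaves]1 - s * (z
    - 1) <= z [^ (- s)] for [z = x / y], which follows from [1 + t <= expR t] and
    [ln z <= z - 1]. *)
Lemma powRN_tangent {R : realType} (s x y : R) : 0 < s -> 0 < x -> 0 < y ->
  y `^ (- s) - x `^ (- s) <= s * (x - y) * y `^ (- s - 1).
Proof.
move=> s0 x0 y0; have z0 : 0 < x / y by rewrite divr_gt0.
have -> : x `^ (- s) = y `^ (- s) * (x / y) `^ (- s).
  by rewrite -powRM ?ltW // mulrC divfK // gt_eqF.
have le_z : 1 - s * (x / y - 1) <= (x / y) `^ (- s).
  rewrite /powR (gt_eqF z0); apply: le_trans (expR_ge1Dx _).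
  rewrite lerD2l mulNr lerN2 ler_pM2l //.
  rewrite -[in leLHS](subrK 1 (x / y)) [_ - 1 + 1]addrC le_ln1Dx //; lra.
rewrite powRNB1 //; set u := y `^ (- s); have u0 : 0 < u by rewrite powR_gt0.
have := ler_wpM2l (ltW u0) le_z.
suff -> : s * (x - y) * (u / y) = u - u * (1 - s * (x / y - 1)) by lra.
by field; rewrite gt_eqF.
Qed.

(** * Partial sums of zeta and the strict Chebyshev inequality *)

Definition zeta_part {R : realType} (s : R) : R^nat :=
  series (fun n : nat => n.+1%:R `^ (- s)).

Lemma zeta_partS {R : realType} (s : R) n :
  zeta_part s n.+1 = zeta_part s n + n.+1%:R `^ (- s).
Proof. by rewrite /zeta_part /series /= big_nat_recr. Qed.

Lemma zeta_part1 {R : realType} (s : R) : zeta_part s 1 = 1.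
Proof. by rewrite /zeta_part /series /= big_nat1 powR1. Qed.

Lemma nondecreasing_zeta_part {R : realType} (s : R) :
  nondecreasing_seq (zeta_part s).
Proof.
by apply/nondecreasing_seqP => n; rewrite zeta_partS lerDl powR_ge0.
Qed.

Lemma cvg_zeta_part {R : realType} (s : R) : 1 < s ->
  zeta_part s @ \oo --> zeta s.
Proof.
move=> s1; apply: (nondecreasing_is_cvgn (nondecreasing_zeta_part s)).
exists (1 + (s - 1)^-1) => _ [n _ <-].
have s0 : 0 < s - 1 by rewrite subr_gt0.
apply: (@le_trans _ _ (1 + (s - 1)^-1 * (1 - n.+1%:R `^ (- (s - 1)))));
  last first.
  by rewrite lerD2l ler_piMr ?invr_ge0 ?ltW // lerBlDr lerDl powR_ge0.
apply: le_trans (nondecreasing_zeta_part s n n.+1 (leqnSn n)) _.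
elim: n => [|n IHn].
  by rewrite zeta_part1 powR1 subrr mulr0 addr0.
rewrite zeta_partS -lerBrDr; apply: le_trans IHn _.
rewrite -addrA lerD2l lerBrDr -lerBrDl -mulrBr ler_pdivlMl //.
have := powRN_tangent (s - 1) n.+1%:R n.+2%:R s0 (ltr0Sn _ _) (ltr0Sn _ _).
rewrite (_ : - (s - 1) - 1 = - s); last by ring.
rewrite (_ : n.+1%:R - n.+2%:R = - 1 :> R); last by rewrite -natr1; ring.
lra.
Qed.

Lemma zeta_ge1 {R : realType} (s : R) : 1 < s -> 1 <= zeta s.
Proof.
move=> s1; have zc := cvg_zeta_part _ s1.
have := nondecreasing_cvgn_le (nondecreasing_zeta_part s) _ 1%N.
by rewrite zeta_part1; apply; apply/cvg_ex; exists (zeta s).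
Qed.

(** With [w = n + 1], the increment at [n] is a sum over [v = 1, ..., n] of positive multiples of
    [(w - v) * (w]^ (a - b) - v [^ (a - b))], whose two factors have the same sign; the diagonal
    terms cancel. *)
Lemma zeta_part_chebyshev {R : realType} (a b : R) : b < a ->
  {homo (fun n => zeta_part (a + 1) n * zeta_part b n
          - zeta_part a n * zeta_part (b + 1) n) : m n / (m <= n)%N >-> m <= n}.
Proof.
move=> ba; apply/nondecreasing_seqP => n; rewrite !zeta_partS.
set w := n.+1%:R : R; have w0 : 0 < w by rewrite ltr0Sn.
rewrite -subr_ge0.
set D := (X in 0 <= X).
have -> : D = zeta_part (a + 1) n * w `^ (- b)
       + w `^ (- (a + 1)) * zeta_part b n
       - (zeta_part a n * w `^ (- (b + 1)) + w `^ (- a) * zeta_part (b + 1) n).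
  have e : w `^ (- (a + 1)) * w `^ (- b) = w `^ (- a) * w `^ (- (b + 1)).
    by rewrite !opprD !powRNB1 //; ring.
  rewrite /D; ring: e.
rewrite /zeta_part /series /= !mulr_suml !mulr_sumr -!big_split -sumrB /=.
rewrite big_nat sumr_ge0 // => i /andP[_ lt_in].
set v := i.+1%:R : R; have v0 : 0 < v by rewrite ltr0Sn.
have le_vw : v <= w by rewrite ler_nat ltnW.
have le_pow : v `^ (a - b) <= w `^ (a - b).
  by rewrite ge0_ler_powR ?nnegrE ?(ltW v0) ?(ltW w0) // subr_ge0 ltW.
have split_b x : 0 < x -> x `^ (- b) = x `^ (a - b) * x `^ (- a).
  by move=> x0; rewrite -powRD ?(gt_eqF x0) ?implybT //; congr (_ `^ _); ring.
rewrite !opprD !powRNB1 // !split_b //.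
set V := v `^ (a - b) in le_pow *; set W := w `^ (a - b) in le_pow *.
set p := v `^ (- a); set q := w `^ (- a).
have -> : p / v * (W * q) + q / w * (V * p) +
   (- (p * (W * q / w)) - q * (V * p / v)) =
   p * q / (v * w) * ((w - v) * (W - V)).
  by field; rewrite !gt_eqF.
by rewrite !mulr_ge0 ?invr_ge0 ?mulr_ge0 ?subr_ge0 ?powR_ge0 // ltW.
Qed.

Lemma zeta_ratio_lt {R : realType} (a b : R) : 1 < b -> b < a ->
  zeta a * zeta (b + 1) < zeta (a + 1) * zeta b.
Proof.
move=> b1 ba; rewrite -subr_gt0.
set T := fun n => zeta_part (a + 1) n * zeta_part b n
          - zeta_part a n * zeta_part (b + 1) n.
(* Monotonicity alone yields a weak inequality in the limit. Strictness comes from index 2, the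
   first one where [T] is nonzero. *)
have T2 : 0 < T 2.
  rewrite /T !(zeta_partS _ 1) !zeta_part1 !opprD !powRNB1 //.
  have : (2 : R) `^ (- a) < 2 `^ (- b).
    by rewrite /powR gt_eqF // ltr_expR ltr_pM2r ?ltrN2 // ln_gt0 // ltr1n.
  set u := _ `^ _; set v := _ `^ _ => uv.
  have -> : (1 + u / 2) * (1 + v) - (1 + u) * (1 + v / 2) = (v - u) / 2.
    by field.
  by rewrite divr_gt0 // subr_gt0.
apply: lt_le_trans T2 _.
have cT : T n @[n --> \oo] --> zeta (a + 1) * zeta b - zeta a * zeta (b + 1).
  by apply: cvgB; apply: cvgM; apply: cvg_zeta_part; lra.
apply: (cvgr_to_ge cT); near=> n; apply: zeta_part_chebyshev => //.
by near: n; exists 2%N.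
Unshelve. all: by end_near. Qed.

(** * Energy of a spear and displacement of its end particle *)

Lemma dotv_vec3 {R : realType} (a b c a' b' c' : R) :
  dotv (vec3 a b c) (vec3 a' b' c') = a * a' + b * b' + c * c'.
Proof. by rewrite /dotv !big_ord_recr big_ord0 /= !mxE /= add0r. Qed.

Lemma spear_pos_sub {R : realType} {N : nat} (P : 'rV[R]_N) (k l : 'I_N) :
  spear_pos P k - spear_pos P l = vec3 (P 0 k - P 0 l) 0 0.
Proof.
by apply/rowP => i; rewrite !mxE; case: i => [[|[|[|//]]] /= _]; rewrite ?subrr.
Qed.

Lemma enorm_axis {R : realType} (r : R) : enorm (vec3 r 0 0) = `|r|.
Proof. by rewrite /enorm dotv_vec3 !mulr0 !addr0 -expr2 sqrtr_sqr. Qed.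

Definition pair_energy {R : realType} (A B alpha beta r : R) : R :=
  A * r `^ (- alpha) - B * r `^ (- beta).

(** Moments aligned with the axis turn the dipolar coefficient into [B0 - (B + B0) = - B]. The
    smaller index is summed outside, so that the first outer term collects all interactions of the
    first particle. *)
Lemma spear_energyE {R : realType} (A B B0 alpha beta : R) {N : nat}
    (P : 'rV[R]_N) : increasing P ->
  spear_energy A B B0 alpha beta P =
  \sum_(l < N) \sum_(k < N | (l < k)%N)
     pair_energy A B alpha beta (P 0 k - P 0 l).
Proof.
move=> incP; rewrite /spear_energy /energy (exchange_big_dep xpredT) //=.
apply: eq_bigr => l _; apply: eq_bigr => k lt_lk.
rewrite spear_pos_sub enorm_axis !dotv_vec3 /pair_energy.
set r := P 0 k - P 0 l; have r0 : 0 < r by rewrite subr_gt0 incP.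
rewrite gtr0_norm // powRD ?(gt_eqF r0) ?implybT // !powRN -natr1.
rewrite [1%:R + 1]natr1 powR_mulrn ?ltW //.
by field; rewrite !gt_eqF ?powR_gt0.
Qed.

(* Moving the first particle outwards by [t] cannot decrease the energy, and
   each pair energy is a difference of convex functions. *)
Lemma spear_minimizer_end {R : realType} (A B B0 alpha beta : R) {n : nat}
    (P : 'rV[R]_n.+1) (t : R) : 0 <= A -> 0 <= B -> 0 < alpha -> 0 < beta ->
  spear_minimizer A B B0 alpha beta P -> 0 < t ->
  alpha * A * \sum_(j < n) (P 0 (lift ord0 j) - P 0 ord0 + t) `^ (- alpha - 1)
  <= beta * B * \sum_(j < n) (P 0 (lift ord0 j) - P 0 ord0) `^ (- beta - 1).
Proof.
move=> A0 B_ge0 a0 b0 [incP minP] t0.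
pose Q : 'rV[R]_n.+1 := \row_k (P 0 k - (if k == ord0 then t else 0)).
have incQ : increasing Q.
  move=> k l lt_kl; rewrite !mxE.
  have /negPf-> : l != ord0.
    by rewrite -val_eqE /= -lt0n (leq_ltn_trans _ lt_kl).
  by have := incP _ _ lt_kl; case: ifP => _; lra.
have r0 j : 0 < P 0 (lift ord0 j) - P 0 ord0 by rewrite subr_gt0 incP.
move: (minP _ incQ); rewrite !spear_energyE //.
rewrite [in leLHS]big_ord_recl [in leRHS]big_ord_recl /=.
set rP := (X in _ + X <= _); set rQ := (X in _ <= _ + X).
have -> : rQ = rP.
  apply: eq_bigr => l _; apply: eq_bigr => k lt_lk; rewrite !mxE /= !subr0.
  have /negPf-> : k != ord0.
    by rewrite -val_eqE /= -lt0n (leq_ltn_trans _ lt_lk).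
  by rewrite subr0.
rewrite lerD2r !(big_mkcond (fun k : 'I_n.+1 => (0 < k)%N)) /=.
rewrite !big_ord_recl /= !add0r => leU; rewrite !mulr_sumr.
rewrite -(ler_pM2r t0) -subr_ge0 !mulr_suml -sumrB.
move: leU; rewrite -subr_ge0 -sumrB => /le_trans; apply; apply: ler_sum => j _.
rewrite !mxE /= subr0 /pair_energy; set r := P 0 (lift ord0 j) - P 0 ord0.
have -> : P 0 (lift ord0 j) - (P 0 ord0 - t) = r + t by rewrite /r; ring.
have rp : 0 < r := r0 j.
have rtp : 0 < r + t by lra.
(* The repulsive part is compared with its tangent at the new distance [r + t], the attractive part
   with its tangent at the old distance [r]; hence [t] survives only in the [alpha] sum. *)
have := ler_wpM2l A0 (powRN_tangent alpha r (r + t) a0 rp rtp).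
have := ler_wpM2l B_ge0 (powRN_tangent beta (r + t) r b0 rtp rp).
have -> : r + t - r = t by ring.
have -> : r - (r + t) = - t by ring.
lra.
Qed.

(** * From uniform gaps to partial zeta sums *)

Lemma powR_continuous_base {R : realType} (s x : R) : 0 < x ->
  {for x, continuous (fun y => y `^ s)}.
Proof.
move=> x0; apply/differentiable_continuous/derivable1_diffP/derivable_powR.
by rewrite in_itv /= x0.
Qed.

Lemma le_powRN {R : realType} (s x y : R) : 0 <= s -> 0 < x -> x <= y ->
  y `^ (- s) <= x `^ (- s).
Proof.
move=> s0 x0 xy; have y0 : 0 < y := lt_le_trans x0 xy.
by rewrite !powRN lef_pV2 ?posrE ?powR_gt0 // ge0_ler_powR // nnegrE ltW.
Qed.

Lemma zeta_part_scale {R : realType} (s a : R) (n : nat) : 0 <= a ->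
  \sum_(j < n) (j.+1%:R * a) `^ (- s) = a `^ (- s) * zeta_part s n.
Proof.
move=> a0; rewrite /zeta_part /series /= big_mkord mulr_sumr.
by apply: eq_bigr => j _; rewrite powRM // mulrC.
Qed.

Lemma dist_of_gaps {R : realType} (n : nat) (P : 'rV[R]_n.+2) (h e : R) :
  (forall j : 'I_n.+1,
     `|P 0 (lift ord0 j) - P 0 (widen_ord (leqnSn n.+1) j) - h| <= e) ->
  forall j : 'I_n.+1,
     `|P 0 (lift ord0 j) - P 0 ord0 - j.+1%:R * h| <= j.+1%:R * e.
Proof.
move=> gap [m]; elim: m => [|m IHm] lt_m.
  by have := gap (Ordinal lt_m); rewrite !mul1r;
    congr (`|_ - P 0 _ - _| <= _); apply: val_inj.
have := IHm (ltnW lt_m); have := gap (Ordinal lt_m).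
have -> : widen_ord (leqnSn n.+1) (Ordinal lt_m)
    = lift ord0 (Ordinal (ltnW lt_m)).
  exact: val_inj.
rewrite /= -[m.+2%:R]natr1 !mulrDl !mul1r.
set x := P 0 _; set y := P 0 (lift _ _); set z := P 0 ord0 => xy yz.
have -> : x - z - (m.+1%:R * h + h) =
  (y - z - m.+1%:R * h) + (x - y - h) by ring.
by apply: le_trans (ler_normD _ _) _; apply: lerD.
Qed.

(** An error proportional to [h] bounds the distance to the first particle by multiples of [j + 1],
    so both sums of the end condition become partial zeta sums. The displacement is also [h * e], at
    most [(j + 1) * (h * e)], whence the factor [1 + 2 * e]. *)
Lemma spear_minimizer_gap_bound {R : realType} (A B B0 alpha beta h e : R)
    (n : nat) (P : 'rV[R]_n.+2) :
  0 <= A -> 0 <= B -> 0 < alpha -> 0 < beta -> 0 < h -> 0 < e < 1 ->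
  spear_minimizer A B B0 alpha beta P ->
  (forall j : 'I_n.+1,
     `|P 0 (lift ord0 j) - P 0 (widen_ord (leqnSn n.+1) j) - h| <= h * e) ->
  alpha * A *
    ((h * (1 + 2 * e)) `^ (- (alpha + 1)) * zeta_part (alpha + 1) n.+1)
  <= beta * B *
    ((h * (1 - e)) `^ (- (beta + 1)) * zeta_part (beta + 1) n.+1).
Proof.
move=> A0 B_ge0 a0 b0 h0 /andP[e0 e1] minP /dist_of_gaps gap.
have he0 : 0 < h * e by rewrite mulr_gt0.
have hd0 : 0 < h * (1 - e) by rewrite mulr_gt0 // subr_gt0.
have hc0 : 0 < h * (1 + 2 * e) by rewrite mulr_gt0 //; lra.
have lower (j : 'I_n.+1) :
    j.+1%:R * (h * (1 - e)) <= P 0 (lift ord0 j) - P 0 ord0.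
  by have := gap j; rewrite ler_norml => /andP[]; lra.
have upper (j : 'I_n.+1) :
    P 0 (lift ord0 j) - P 0 ord0 + h * e <= j.+1%:R * (h * (1 + 2 * e)).
  have : h * e <= j.+1%:R * (h * e) by rewrite ler_pMl // ler1n.
  by have := gap j; rewrite ler_norml => /andP[_]; lra.
rewrite -!zeta_part_scale ?(ltW hc0) ?(ltW hd0) //.
have le_end := spear_minimizer_end _ _ _ _ _ _ _ A0 B_ge0 a0 b0 minP he0.
apply: (le_trans _ (le_trans le_end _)).
  rewrite ler_wpM2l ?mulr_ge0 ?(ltW a0) //; apply: ler_sum => j _.
  rewrite -opprD le_powRN ?upper //; first lra.
  apply: lt_le_trans (_ : j.+1%:R * (h * (1 - e)) <= _).
    by rewrite mulr_gt0.
  by have := lower j; lra.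
rewrite ler_wpM2l ?mulr_ge0 ?(ltW b0) //; apply: ler_sum => j _.
by rewrite -opprD le_powRN ?lower // ?mulr_gt0 //; lra.
Qed.

(** Uniformity follows by testing a single selection that picks, for each [n], an index violating
    the bound whenever there is one. *)
Lemma cvg_all_selections {R : realType} (f : forall n : nat, 'I_n.+1 -> R)
    (l : R) :
  (forall k : forall n, 'I_n.+1, f n (k n) @[n --> \oo] --> l) ->
  forall e, 0 < e -> \forall n \near \oo, forall j, `|f n j - l| <= e.
Proof.
move=> cf e e0.
pose k n := odflt ord0 [pick j : 'I_n.+1 | e < `|f n j - l|].
have /cvgrPdist_le/(_ e e0) := cf k; apply: filterS => n; rewrite /k.
case: pickP => [j /= lt_e|le_e _ j]; last by rewrite leNgt le_e.
by rewrite distrC leNgt lt_e.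
Qed.

(** * The bulk spacing and the contradiction *)

Lemma hbar_gt0 {R : realType} (A B alpha beta : R) :
  0 < A -> 0 < B -> 1 < beta -> beta < alpha -> 0 < hbar A B alpha beta.
Proof.
move=> A0 B0 b1 ba; rewrite powR_gt0 //.
have := zeta_ge1 alpha (lt_trans b1 ba); have := zeta_ge1 beta b1 => zb za.
by rewrite !(mulr_gt0, invr_gt0) //; lra.
Qed.

Lemma hbar_powR {R : realType} (A B alpha beta : R) :
  0 < A -> 0 < B -> 1 < beta -> beta < alpha ->
  hbar A B alpha beta `^ (alpha - beta) =
  alpha * A * zeta alpha / (beta * B * zeta beta).
Proof.
move=> A0 B0 b1 ba; rewrite /hbar -powRrM mulVf ?gt_eqF ?subr_gt0 // powRr1 //.
have := zeta_ge1 alpha (lt_trans b1 ba); have := zeta_ge1 beta b1 => zb za.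
by rewrite !(mulr_ge0, invr_ge0) //; lra.
Qed.

(* [P n] is the minimizer for [n.+2] particles, so that [n] ranging over [nat]
   amounts to [N = n.+2] ranging over the integers [>= 2]; the indices [k]
   and [k + 1] in ['I_n.+2] of an index [k : 'I_n.+1] are
   [widen_ord (leqnSn n.+1) k] and [lift ord0 k]. *)
Theorem proposition1p2 (R : realType) (A B B0 alpha beta : R)
    (A_gt0 : 0 < A) (B_gt0 : 0 < B) (B0_gt0 : 0 < B0)
    (beta_gt1 : 1 < beta) (alpha_gt_beta : beta < alpha)
    (P : forall n : nat, 'rV[R]_n.+2)
    (P_min : forall n : nat, spear_minimizer A B B0 alpha beta (P n)) :
  exists k : forall n : nat, 'I_n.+1,
    ~ ((fun n : nat =>
          enorm (spear_pos (P n) (lift ord0 (k n))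
                 - spear_pos (P n) (widen_ord (leqnSn n.+1) (k n))))
         @ \oo --> hbar A B alpha beta).
Proof.
apply/not_existsP => all_cvg.
set h := hbar A B alpha beta in all_cvg *.
have h0 : 0 < h by exact: hbar_gt0.
have gaps e : 0 < e -> \forall n \near \oo, forall j : 'I_n.+1,
    `|P n 0 (lift ord0 j) - P n 0 (widen_ord (leqnSn n.+1) j) - h| <= h * e.
  move=> e0; apply: (cvg_all_selections (fun n (j : 'I_n.+1) =>
    P n 0 (lift ord0 j) - P n 0 (widen_ord (leqnSn n.+1) j))); last first.
    by rewrite mulr_gt0.
  move=> k; have /contrapT := all_cvg k; apply: cvg_trans; apply: near_eq_cvg.
  near=> n; rewrite spear_pos_sub enorm_axis gtr0_norm // subr_gt0.
  by have [incP _] := P_min n; apply: incP; rewrite /= /bump.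
have part_cvg s : 1 < s -> zeta_part s n.+1 @[n --> \oo] --> zeta s.
  by move=> s1; rewrite cvg_shiftS; apply: cvg_zeta_part.
have zeta_bound e : 0 < e < 1 ->
    alpha * A * ((h * (1 + 2 * e)) `^ (- (alpha + 1)) * zeta (alpha + 1))
    <= beta * B * ((h * (1 - e)) `^ (- (beta + 1)) * zeta (beta + 1)).
  move=> e01; have /andP[e0 e1] := e01.
  (* First limit: [n] tends to infinity with [e] fixed, so the partial sums become zeta values. *)
  apply: (@ler_cvg_to _ \oo _ _
    (fun n => alpha * A *
      ((h * (1 + 2 * e)) `^ (- (alpha + 1)) * zeta_part (alpha + 1) n.+1))
    (fun n => beta * B *
      ((h * (1 - e)) `^ (- (beta + 1)) * zeta_part (beta + 1) n.+1))).
  - by apply: cvgMl_tmp; apply: cvgMl_tmp; apply: part_cvg; lra.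
  - by apply: cvgMl_tmp; apply: cvgMl_tmp; apply: part_cvg; lra.
  by apply: filterS (gaps e e0) => n;
    apply: (spear_minimizer_gap_bound _ _ B0) => //; lra.
have limit_bound : alpha * A * (h `^ (- (alpha + 1)) * zeta (alpha + 1))
    <= beta * B * (h `^ (- (beta + 1)) * zeta (beta + 1)).
  (* Second limit: [e] tends to 0 from the right, since the bound is available only for positive
     [e]. *)
  apply: (@ler_cvg_to _ (0 : R)^'+ _ _
    (fun e => alpha * A *
      ((h * (1 + 2 * e)) `^ (- (alpha + 1)) * zeta (alpha + 1)))
    (fun e => beta * B *
      ((h * (1 - e)) `^ (- (beta + 1)) * zeta (beta + 1)))).
  - apply: cvgMl_tmp; apply: cvgMr_tmp; apply: cvg_at_right_filter.
    apply: (continuous_cvg _ (powR_continuous_base _ h h0)).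
    rewrite -[X in _ --> X](_ : h * (1 + 2 * 0) = h); last by ring.
    by apply: cvgMl_tmp; apply: cvgD; [exact: cvg_cst|apply: cvgMl_tmp].
  - apply: cvgMl_tmp; apply: cvgMr_tmp; apply: cvg_at_right_filter.
    apply: (continuous_cvg _ (powR_continuous_base _ h h0)).
    rewrite -[X in _ --> X](_ : h * (1 - 0) = h); last by ring.
    by apply: cvgMl_tmp; apply: cvgB; [exact: cvg_cst|].
  near=> e; apply: zeta_bound; apply/andP; split; near: e.
    exact: nbhs_right_gt.
  exact: nbhs_right_lt.
have := zeta_ratio_lt alpha beta beta_gt1 alpha_gt_beta.
rewrite ltNge => /negP; apply.
have zb0 : 0 < zeta beta by have := zeta_ge1 beta beta_gt1; lra.
have hab := hbar_powR A B alpha beta A_gt0 B_gt0 beta_gt1 alpha_gt_beta.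
rewrite -/h in hab.
have hb : h `^ (- (beta + 1)) = h `^ (alpha - beta) * h `^ (- (alpha + 1)).
  rewrite -powRD ?(gt_eqF h0) ?implybT //; congr (_ `^ _); ring.
rewrite hb hab in limit_bound.
have u0 : 0 < alpha * A * h `^ (- (alpha + 1)) / zeta beta.
  by rewrite divr_gt0 // !mulr_gt0 ?(powR_gt0 _ h0) //; lra.
rewrite -(ler_pM2l u0).
set u := h `^ _ in limit_bound *.
have -> : alpha * A * u / zeta beta * (zeta (alpha + 1) * zeta beta) =
  alpha * A * (u * zeta (alpha + 1)) by field; rewrite gt_eqF.
apply: le_trans limit_bound _; rewrite le_eqVlt; apply/orP; left; apply/eqP.
by field; rewrite !gt_eqF //; lra.
Unshelve. all: by end_near. Qed.
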